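(* Let $f:\mathbb{Z}\to\mathbb{R}$ be a function in $\ell^1(\mathbb{Z})$. Then $$\mathrm{Var}(Mf)\le\Big(2+\frac{146}{315}\Big)\|f\|_{\ell^1(\mathbb{Z})}.$$
   Context: Let $\mathbb{Z}^+=\{0,1,2,\dots\}$. For $f:\mathbb{Z}\to\mathbb{R}$, the discrete centered Hardy–Littlewood maximal operator is $$Mf(n)=\sup_{r\in\mathbb{Z}^+}\frac{1}{2r+1}\sum_{k=-r}^{r}|f(n+k)|,\qquad n\in\mathbb{Z}.$$ The total variation of $g:\mathbb{Z}\to\mathbb{R}$ is $\mathrm{Var}(g)=\sum_{n=-\infty}^{\infty}|g(n+1)-g(n)|$, and $\|f\|_{\ell^1(\mathbb{Z})}=\sum_{n\in\mathbb{Z}}|f(n)|$. *)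

(* Defs.v *)
From HB Require Import structures.
From mathcomp Require Import all_boot all_order all_algebra.
From mathcomp Require Import all_classical all_reals all_analysis.
Set Implicit Arguments. Unset Strict Implicit. Unset Printing Implicit Defensive.
Import Order.TTheory GRing.Theory Num.Theory.
Local Open Scope classical_set_scope.
Local Open Scope ring_scope.

Definition cavg (R : realType) (f : int -> R) (n : int) (r : nat) : R :=
  ((2 * r + 1)%:R)^-1 * \sum_(k < (2 * r).+1) `|f (n - r%:Z + k%:Z)|.

(* discrete centered Hardy-Littlewood maximal function (real sup; the set of
   averages is bounded for f in l^1) *)
Definition maxf (R : realType) (f : int -> R) (n : int) : R :=
  sup [set cavg f n r | r in [set: nat]].

Definition l1norm (R : realType) (f : int -> R) : \bar R :=
  (\esum_(n in [set: int]) (`|f n|)%:E)%E.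

Definition in_l1 (R : realType) (f : int -> R) : Prop :=
  (l1norm f < +oo)%E.

Definition totvar (R : realType) (g : int -> R) : \bar R :=
  (\esum_(n in [set: int]) (`|g (n + 1) - g n|)%:E)%E.

(* Main.v *)
Require Import Defs.
From mathcomp Require Import all_boot all_order all_algebra.
From mathcomp Require Import all_classical all_reals all_analysis.
From mathcomp Require Import zify ring lra.
Import Order.TTheory GRing.Theory Num.Theory.
Local Open Scope ring_scope.

(** If the average of [|f|] of radius [r] at [p] is compared with the one of
    radius [r + 1] at a neighbour [q] of [p], whose window is larger, then
    [Mf(p) - Mf(q)] is at most the supremum over [r] of
    [(1/(2r+1) - 1/(2r+3)) * \sum_(|m - p| <= r) |f m|], and in each such sum
    the weight may be replaced by the larger [1/(2t+1) - 1/(2t+3)] with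
    [t = |m - p|].  Hence [|Mf(n+1) - Mf(n)| <= \sum_m |f m| * k(n - m)] with
    [k(z) = 1/(2z+1) - 1/(2z+3)] for [z >= 0] and [k(z) = k(-z-1)] for [z < 0].
    On each half line the sum of [k] telescopes to [1], so summing over [n]
    bounds the variation by [2 * ||f||_1]. *)

Lemma sum_window_le_esum (R : realType) (F : int -> R) (a : int) (N : nat) :
  (forall m, 0 <= F m) ->
  ((\sum_(k < N) F (a + k%:Z))%:E <= \esum_(m in [set: int]) (F m)%:E)%E.
Proof.
move=> F0; apply: esum_ge; pose s := [seq a + k%:Z | k <- iota 0 N].
have us : uniq s by rewrite map_inj_uniq ?iota_uniq// => x y; lia.
exists [set` s]%classic; first by split; [exact: finite_seq|exact: subsetT].
rewrite -fsbig_seq// sumEFin lee_fin big_map.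
by rewrite -(big_mkord xpredT (fun k => F (a + k%:Z))) /index_iota subn0.
Qed.

(** The increments are nonnegative, so [s] may be enlarged to an interval [[-N, N)], over which they
    telescope to [h N - h (-N)]. *)
Lemma sum_increments_le (R : realType) (h : int -> R) (l u : R) (s : seq int) :
  (forall z, h z <= h (z + 1)) -> (forall z, l <= h z <= u) -> uniq s ->
  \sum_(z <- s) (h (z + 1) - h z) <= u - l.
Proof.
move=> hS hlu us; pose N := (\max_(z <- s) `|z|%N).+1.
pose t : seq int := [seq - N%:Z + k%:Z | k <- iota 0 (N + N)].
have st : {subset s <= t}.
  move=> z zs; have zN : (`|z| < N)%N by rewrite ltnS; exact: leq_bigmax_seq.
  apply/mapP; exists (absz (z + N%:Z)); last by lia.
  by rewrite mem_iota; lia.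
have ut : uniq t by rewrite map_inj_uniq ?iota_uniq// => x y; lia.
have incr0 z : 0 <= h (z + 1) - h z by rewrite subr_ge0.
apply: (@le_trans _ _ (\sum_(z <- t) (h (z + 1) - h z))).
  rewrite (bigID (mem s) xpredT (r := t))/= -[leLHS]addr0 lerD ?sumr_ge0//.
  rewrite -[leRHS]big_filter.
  suff ts : perm_eq [seq z <- t | z \in s] s by rewrite (perm_big _ ts).
  apply: uniq_perm; rewrite ?filter_uniq// => z; rewrite mem_filter/=.
  by case: (boolP (z \in s)) => // /st ->.
rewrite big_map.
have -> : \sum_(k <- iota 0 (N + N)) (h (- N%:Z + k%:Z + 1) - h (- N%:Z + k%:Z))
    = h N%:Z - h (- N%:Z).
  have := @telescope_sumr R 0 (N + N) (fun k => h (- N%:Z + k%:Z)) (leq0n _).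
  rewrite /index_iota subn0 addr0 PoszD addKr => <-.
  by apply: eq_bigr => k _; congr (h _ - _); lia.
by have /andP[_ ?] := hlu N%:Z; have /andP[? _] := hlu (- N%:Z); lra.
Qed.

Section ramp.
Variable R : realType.
Implicit Types (z : int) (r : nat).

(* An increasing function from [0] at [-oo] to [2] at [+oo], whose increments
   are the kernel [k]. *)
Definition ramp z : R :=
  if 0 <= z then 2 - (2 * z%:~R + 1)^-1 else (1 - 2 * z%:~R)^-1.

Lemma ramp_itv z : 0 <= ramp z <= 2.
Proof.
have inv01 (x : R) : 1 <= x -> 0 <= x^-1 <= 1.
  by move=> x1; rewrite invr_ge0 invf_le1 ?x1 ?(le_trans ler01)// (lt_le_trans ltr01).
rewrite /ramp; case: ifP => z0.
  have z0R : 0 <= z%:~R :> R by rewrite ler0z.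
  by have /andP[] := inv01 (2 * z%:~R + 1) ltac:(lra); lra.
have z0R : z%:~R <= 0 :> R by rewrite lerz0; lia.
by have /andP[] := inv01 (1 - 2 * z%:~R) ltac:(lra); lra.
Qed.

Lemma inv_odd_diff_anti (x y : R) : 0 <= x -> x <= y ->
  (2 * y + 1)^-1 - (2 * y + 3)^-1 <= (2 * x + 1)^-1 - (2 * x + 3)^-1.
Proof.
have E (t : R) : 0 <= t ->
    (2 * t + 1)^-1 - (2 * t + 3)^-1 = 2 * ((2 * t + 1) * (2 * t + 3))^-1.
  by move=> t0; field; apply/andP; split; apply: lt0r_neq0; lra.
move=> x0 xy; rewrite !E ?(le_trans x0)// ler_pM2l// lef_pV2 ?posrE; nra.
Qed.

(** The range of [z] is that of [n - m] when [m] runs over the windows of radius [r] at [n] and at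
    [n + 1]; hence the asymmetry. *)
Lemma ramp_increment z r : - r%:Z - 1 <= z <= r%:Z ->
  (2 * r + 1)%:R^-1 - (2 * r.+1 + 1)%:R^-1 <= ramp (z + 1) - ramp z.
Proof.
move=> /andP[rz zr].
have -> : (2 * r + 1)%:R = 2 * r%:R + 1 :> R by rewrite natrD natrM.
have -> : (2 * r.+1 + 1)%:R = 2 * r%:R + 3 :> R.
  by rewrite natrD natrM -natr1; ring.
have rR : r%:R = r%:Z%:~R :> R by [].
rewrite /ramp; case: (leP 0 z) => z0.
  rewrite ifT; last by lia.
  have z0R : 0 <= z%:~R :> R by rewrite ler0z.
  have zrR : z%:~R <= r%:R :> R by rewrite rR ler_int.
  have := inv_odd_diff_anti _ _ z0R zrR.
  have -> : 2 * (z + 1)%:~R + 1 = 2 * z%:~R + 3 :> R by rewrite intrD; ring.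
  by lra.
have z0R : 0 <= (- z - 1)%:~R :> R by rewrite ler0z; lia.
have zrR : (- z - 1)%:~R <= r%:R :> R by rewrite rR ler_int; lia.
have := inv_odd_diff_anti _ _ z0R zrR.
have -> : 2 * (- z - 1)%:~R + 3 = 1 - 2 * z%:~R :> R.
  by rewrite intrD !mulrNz; ring.
have e : 2 * (- z - 1)%:~R + 1 = 1 - 2 * (z + 1)%:~R :> R.
  by rewrite !intrD !mulrNz; ring.
(* Only here do [z] and [z + 1] fall in different branches of [ramp]; both formulas give 1 at 0. *)
rewrite e; case: ifP => // z1; have -> : z = - 1 by lia.
by rewrite addNr mulr0z mulr0 subr0 add0r invr1; lra.
Qed.

Lemma ramp_nondecreasing z : ramp z <= ramp (z + 1).
Proof.
rewrite -subr_ge0; apply: le_trans (@ramp_increment z `|z|%N _); last by lia.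
by rewrite subr_ge0 lef_pV2 ?posrE ?ltr0n ?ler_nat; lia.
Qed.

End ramp.

Section maximal_function.
Variables (R : realType) (f : int -> R).
Hypothesis f_l1 : in_l1 f.

(** Summability bounds all averages by the norm, so the real [sup] is a genuine upper bound and not
    a default value. *)
Lemma cavg_le_maxf n r : cavg f n r <= maxf f n.
Proof.
apply: ub_le_sup; last by exists r.
exists (fine (l1norm f)) => _ [q _ <-].
have l1_fin : l1norm f \is a fin_num.
  by rewrite ge0_fin_numE//; apply: esum_ge0 => m _; rewrite lee_fin.
have := @sum_window_le_esum R (fun m => `|f m|) (n - q%:Z) (2 * q).+1
  (fun=> normr_ge0 _).
rewrite -/(l1norm f) -{1}(fineK l1_fin) lee_fin; apply: le_trans.
rewrite /cavg ler_piMl ?sumr_ge0// invf_le1 ?ltr0n; last by lia.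
by rewrite ler1n; lia.
Qed.

Lemma maxf_le n (x : R) : (forall r, cavg f n r <= x) -> maxf f n <= x.
Proof.
by move=> nx; apply: ge_sup; [exists (cavg f n 0%N), 0%N|move=> _ [r _ <-]].
Qed.

(* The window of radius [r] at [p] lies in the one of radius [r + 1] at a
   neighbour [q], starting at its first or its third element. *)
Lemma sum_window_neighbour (p q : int) r : (q == p + 1) || (p == q + 1) ->
  \sum_(k < (2 * r).+1) `|f (p - r%:Z + k%:Z)|
  <= \sum_(k < (2 * r.+1).+1) `|f (q - r.+1%:Z + k%:Z)|.
Proof.
have -> : ((2 * r.+1) = (2 * r).+2)%N by lia.
move=> /orP[] /eqP ->.
  rewrite [leRHS]big_ord_recr [X in _ <= X + _]big_ord_recr/= -addrA.
  rewrite ler_wpDr ?addr_ge0// le_eqVlt; apply/orP; left; apply/eqP.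
  by apply: eq_bigr => k _; congr (`|f _|); lia.
rewrite [leRHS]big_ord_recl [X in _ <= _ + X]big_ord_recl/= addrA.
rewrite ler_wpDl ?addr_ge0// le_eqVlt; apply/orP; left; apply/eqP.
by apply: eq_bigr => k _; congr (`|f _|); rewrite /bump/=; lia.
Qed.

(** Written so that, for fixed [m], it is the increment at [n] of the shifted function
    [ramp (n - m)]. *)
Local Notation kernel n m := (ramp R (n + 1 - m) - ramp R (n - m)).

Lemma kernel_ge0 (n m : int) : 0 <= kernel n m.
Proof.
have -> : n + 1 - m = n - m + 1 by lia.
by rewrite subr_ge0 ramp_nondecreasing.
Qed.

(** Both orders of the neighbours are allowed, with the same kernel, so that the two signs of the
    increment are covered. *)
Lemma maxf_neighbour_diff (n p q : int) (S : R) :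
  ((p == n) && (q == n + 1)) || ((p == n + 1) && (q == n)) ->
  (\esum_(m in [set: int]) (`|f m| * kernel n m)%:E <= S%:E)%E ->
  maxf f p - maxf f q <= S.
Proof.
move=> pq hS; rewrite lerBlDr; apply: maxf_le => r; rewrite -lerBlDr.
apply: le_trans (lerB (lexx _) (cavg_le_maxf q r.+1)) _.
rewrite -lee_fin; apply: le_trans hS.
apply: le_trans (@sum_window_le_esum R (fun m => `|f m| * kernel n m)
  (p - r%:Z) (2 * r).+1 _); last by move=> m; rewrite mulr_ge0 ?kernel_ge0.
rewrite lee_fin.
(* In the subtracted average at [q] only the window of [p] is kept, so that both sums run over it
   and the weights subtract. *)
apply: (@le_trans _ _ (\sum_(k < (2 * r).+1) `|f (p - r%:Z + k%:Z)| *
    ((2 * r + 1)%:R^-1 - (2 * r.+1 + 1)%:R^-1))).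
  rewrite -mulr_suml mulrBr /cavg mulrC lerB// mulrC.
  rewrite ler_pM2l ?invr_gt0 ?ltr0n; last by lia.
  by apply: sum_window_neighbour; lia.
apply: ler_sum => k _; rewrite ler_wpM2l//.
set m := p - r%:Z + k%:Z; have -> : n + 1 - m = n - m + 1 by lia.
by apply: ramp_increment; have := ltn_ord k; rewrite /m; lia.
Qed.

Lemma maxf_increment_le (n : int) :
  ((`|maxf f (n + 1) - maxf f n|)%:E
   <= \esum_(m in [set: int]) (`|f m| * kernel n m)%:E)%E.
Proof.
set S := esum _ _.
have S0 : (0 <= S)%E.
  by apply: esum_ge0 => m _; rewrite lee_fin mulr_ge0 ?kernel_ge0.
(* An infinite [S] makes the bound trivial. *)
case E : S S0 => [x| |] // _; last by rewrite leey.
have Sx : (S <= x%:E)%E by rewrite E.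
rewrite lee_fin ler_norml lerNl opprB.
by apply/andP; split; apply: (maxf_neighbour_diff _ _ _ _ _ Sx); rewrite !eqxx ?orbT.
Qed.

Lemma totvar_maxf_le : (totvar (maxf f) <= 2%:E * l1norm f)%E.
Proof.
apply: ge_ereal_sup => _ [A [finA _]] <-; rewrite fsbig_finite//=.
apply: le_trans (lee_sum _ (fun n _ => maxf_increment_le n)) _.
(* Exchanging the sums leaves, for each [m], a finite sum of increments of [ramp] in [n], at most
   2. *)
rewrite -esum_sum; last first.
  by move=> m n _ _; rewrite lee_fin mulr_ge0 ?kernel_ge0.
have -> : (2%:E * l1norm f = \esum_(m in [set: int]) (`|f m| * 2)%:E)%E.
  rewrite /l1norm mule_natl mule2n -esumD; try by move=> m _; rewrite lee_fin.
  by apply: eq_esum => m _; rewrite -EFinD; congr _%:E; ring.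
apply: le_esum => m _; rewrite sumEFin lee_fin -mulr_sumr ler_wpM2l//.
rewrite -[leRHS]subr0.
apply: (@sum_increments_le R (fun n => ramp R (n - m)) 0 2).
- move=> z; have -> : z + 1 - m = z - m + 1 by lia.
  exact: ramp_nondecreasing.
- by move=> z; exact: ramp_itv.
- exact: finmap.fset_uniq.
Qed.

End maximal_function.

Theorem theorem2 (R : realType) (f : int -> R) :
  in_l1 f ->
  (totvar (maxf f) <= (2 + 146 / 315 : R)%:E * l1norm f)%E.
Proof.
move=> f_l1; apply: le_trans (@totvar_maxf_le R f f_l1) _.
apply: lee_wpmul2r; first by apply: esum_ge0 => m _; rewrite lee_fin.
by rewrite lee_fin; lra.
Qed.
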